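(* Let $\omega_3=e^{2\pi i/3}$ and consider the unitary matrices $$U_3^{c}=\frac{1}{\sqrt3}\begin{pmatrix}1&1&1\\1&\omega_3&\omega_3^2\\1&\omega_3^2&\omega_3\end{pmatrix},\qquad U_3^{q}=\frac{1}{\sqrt2}\begin{pmatrix}0&1&1\\ \sqrt2&0&0\\0&1&-1\end{pmatrix},$$ whose columns are the coordinates, in the basis $(\ket{1,1},\ket{1,0},\ket{1,-1})$ of $\mathcal H_3$ (spin $j=1$), of the orthonormal bases $$\tfrac{1}{\sqrt3}(\ket{1,1}+\ket{1,0}+\ket{1,-1}),\quad \tfrac{1}{\sqrt3}(\ket{1,1}+\omega_3\ket{1,0}+\omega_3^2\ket{1,-1}),\quad \tfrac{1}{\sqrt3}(\ket{1,1}+\omega_3^2\ket{1,0}+\omega_3\ket{1,-1})$$ and $$\ket{1,0},\quad \tfrac{1}{\sqrt2}(\ket{1,1}+\ket{1,-1}),\quad \tfrac{1}{\sqrt2}(\ket{1,1}-\ket{1,-1}),$$ respectively. Then the first basis is a least quantum basis of $\mathcal H_3$ and the second is a most quantum basis of $\mathcal H_3$ with respect to the quantumness measure $\mathcal B_1$, with $\mathcal B_1(U_3^{c})=\frac19$ and $\mathcal B_1(U_3^{q})=1$. That is, for every unitary $U\in U(3)$, $$\tfrac19=\mathcal B_1(U_3^{c})\le \mathcal B_1(U)\le \mathcal B_1(U_3^{q})=1 .$$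
   Context: For $j\in\{\tfrac12,1,\tfrac32,\dots\}$ let $N=2j+1$ and let $\mathcal H_{N}=\mathbb C^{N}$ be the spin-$j$ Hilbert space with orthonormal basis $\ket{j,m}$, $m=j,j-1,\dots,-j$, of eigenvectors of the angular momentum operator $J_z$. For $0\le k\le 2j$ let $\ket{D_{2j,k}}\in(\mathbb C^2)^{\otimes 2j}$ be the Dicke state: $\binom{2j}{k}^{-1/2}$ times the sum of the $\binom{2j}{k}$ distinct computational basis vectors having exactly $k$ tensor factors $\ket1$ and $2j-k$ tensor factors $\ket0$. Let $F:\mathcal H_{2j+1}\to(\mathbb C^2)^{\otimes 2j}$ be the linear isometry onto the symmetric subspace with $F\ket{j,m}=\ket{D_{2j,j-m}}$. For a unit vector $\ket\psi\in\mathcal H_{2j+1}$ and an integer $1\le t\le 2j$, let $\rho_t$ be the reduced density operator on $t$ qubits obtained from the projector onto $F\ket\psi$ by tracing out $2j-t$ qubits (by symmetry, which ones is irrelevant), and let $R_t(F(\ket\psi))=\mathrm{tr}(\rho_t^2)$. The measure of anticoherence of order $t$ is $$\mathcal A_t(\ket\psi)=\frac{t+1}{t}\bigl[1-R_t(F(\ket\psi))\bigr].$$ A unitary $U\in U(N)$ represents the orthonormal basis $\ket{\psi_1},\dots,\ket{\psi_N}$ of $\mathcal H_N$ whose $i$-th vector is the $i$-th column of $U$, i.e. $U_{ki}=\langle j,m|\psi_i\rangle$ with $m=j+1-k$. The quantumness of the basis is $$\mathcal B_t(U)=\frac1N\sum_{i=1}^N\mathcal A_t(\ket{\psi_i}).$$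 A most (respectively least) quantum basis is one maximizing (respectively minimizing) $\mathcal B_1$ over all $U\in U(N)$. *)

(* Defs.v *)
From mathcomp Require Import all_boot all_order all_algebra.
From mathcomp Require Import reals trigo.
From mathcomp Require Import sesquilinear spectral complex.

Set Implicit Arguments.
Unset Strict Implicit.
Unset Printing Implicit Defensive.

Import Order.TTheory GRing.Theory Num.Theory.
Local Open Scope ring_scope.
Local Open Scope sesquilinear_scope.

(* A spin j is encoded by the natural number n = 2j, so that N = n + 1.       *)
(* The basis |j,m>, m = j, j-1, ..., -j, is indexed by k = j - m in 'I_n.+1.  *)

Section Spin.
Variable C : numClosedFieldType.

Definition spin_ket n (k : 'I_n.+1) : 'cV[C]_n.+1 := delta_mx k 0.

(* Vectors of (C^2)^{(x) n}: coordinates are indexed by the bit strings of    *)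
(* length n through enum_rank/enum_val; true stands for |1>, false for |0>.   *)
Definition qdim n := #|{: n.-tuple bool}|.

Definition bits n (a : 'I_(qdim n)) : n.-tuple bool := enum_val a.

Definition qubit_ket n (x : n.-tuple bool) : 'cV[C]_(qdim n) :=
  delta_mx (enum_rank x) 0.

Definition dicke n (k : nat) : 'cV[C]_(qdim n) :=
  (sqrtC 'C(n, k)%:R)^-1 *:
    \sum_(x : n.-tuple bool | count_mem true x == k) qubit_ket x.

(* The isometry onto the symmetric subspace mapping |j,m> to |D_{2j,j-m}>. *)
Definition dicke_embedding n (psi : 'cV[C]_n.+1) : 'cV[C]_(qdim n) :=
  \sum_(k < n.+1) psi k 0 *: dicke n k.

Definition projector d (phi : 'cV[C]_d) : 'M[C]_d := phi *m phi^t*.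

(* Partial trace over the last n - t qubits (meaningful for t <= n): the      *)
(* entry <x| rho_t |y> is the sum of <xz| rho |yz> over z in {0,1}^(n-t),     *)
(* the strings xz and yz being characterized as the pairs (u, v) of strings   *)
(* with respective prefixes x and y and with the same suffix.                 *)
Definition partial_trace n t (rho : 'M[C]_(qdim n)) : 'M[C]_(qdim t) :=
  \matrix_(a, b)
    \sum_(u : n.-tuple bool | take t u == bits a :> seq bool)
      \sum_(v : n.-tuple bool | (take t v == bits b :> seq bool)
                                && (drop t v == drop t u :> seq bool))
        rho (enum_rank u) (enum_rank v).

Definition purity d (rho : 'M[C]_d) : C := \tr (rho *m rho).

Definition reduced_purity n t (phi : 'cV[C]_(qdim n)) : C :=
  purity (partial_trace t (projector phi)).

(* Intended for unit vectors psi and 1 <= t <= n.                             *)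
Definition anticoherence n t (psi : 'cV[C]_n.+1) : C :=
  t.+1%:R / t%:R * (1 - reduced_purity t (dicke_embedding psi)).

Definition quantumness n t (U : 'M[C]_n.+1) : C :=
  n.+1%:R^-1 * \sum_(i < n.+1) anticoherence t (col i U).

(* On C, [x <= y] means that y - x is a nonnegative real, so the inequalities *)
(* below include the comparability of the two values.                         *)
Definition most_quantum n (U : 'M[C]_n.+1) : Prop :=
  U \is unitarymx /\
  forall V : 'M[C]_n.+1, V \is unitarymx -> quantumness 1 V <= quantumness 1 U.

Definition least_quantum n (U : 'M[C]_n.+1) : Prop :=
  U \is unitarymx /\
  forall V : 'M[C]_n.+1, V \is unitarymx -> quantumness 1 U <= quantumness 1 V.

Definition mx_of_rows m n (s : seq (seq C)) : 'M[C]_(m, n) :=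
  \matrix_(i, j) nth 0 (nth [::] s i) j.

(* |1,1>, |1,0> and |1,-1> *)
Definition ket_p1 : 'cV[C]_3 := @spin_ket 2 (inord 0).
Definition ket_0  : 'cV[C]_3 := @spin_ket 2 (inord 1).
Definition ket_m1 : 'cV[C]_3 := @spin_ket 2 (inord 2).

End Spin.

Section Spin1.
Variable R : realType.

(* e^{i theta}, given by Euler's formula *)
Definition expi (theta : R) : R[i] := Complex (cos theta) (sin theta).

Definition omega3 : R[i] := expi (2 * pi / 3).

Definition U3c : 'M[R[i]]_3 :=
  (sqrtC 3)^-1 *: mx_of_rows 3 3
    [:: [:: 1; 1;           1          ];
        [:: 1; omega3;      omega3 ^+ 2];
        [:: 1; omega3 ^+ 2; omega3     ]].

Definition U3q : 'M[R[i]]_3 :=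
  (sqrtC 2)^-1 *: mx_of_rows 3 3
    [:: [:: 0;       1; 1 ];
        [:: sqrtC 2; 0; 0 ];
        [:: 0;       1; -1]].

End Spin1.

Arguments ket_p1 {C}.
Arguments ket_0 {C}.
Arguments ket_m1 {C}.
Arguments omega3 {R}.

(* Main.v *)
(* For spin 1 the anticoherence of a unit vector psi is |psi^T S psi|^2, where
   S is a symmetric unitary matrix; hence B_1(U) is a third of the sum of the
   |W_ii|^2 for the symmetric unitary matrix W = U^T S U.  The upper bound is
   |W_ii| <= 1.  For the lower bound put s_i = |W_ii|, p = |W_01|, q = |W_02|,
   r = |W_12|.  Orthogonality of the rows of W gives qr <= p (s_0 + s_1) and its
   two analogues; multiplying them in pairs bounds r^2 by
   (s_0 + s_1)(s_0 + s_2), and so on.  Together with the normalization of the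
   rows, the sum of these three bounds gives 1 <= 3 (s_0^2 + s_1^2 + s_2^2). *)
Require Import Defs.
From mathcomp Require Import all_boot all_order all_algebra.
From mathcomp Require Import reals trigo.
From mathcomp Require Import sesquilinear spectral complex ring.

Set Implicit Arguments.
Unset Strict Implicit.
Unset Printing Implicit Defensive.

Import Order.TTheory GRing.Theory Num.Theory.
Local Open Scope ring_scope.

Lemma inord3 : (inord 0 = 0 :> 'I_3) * (inord 1 = 1 :> 'I_3)
  * (inord 2 = 2 :> 'I_3).
Proof. by do !split; apply: val_inj; rewrite /= inordK. Qed.

Lemma sum_ord3 (V : nmodType) (F : 'I_3 -> V) : \sum_i F i = F 0 + F 1 + F 2.
Proof.
rewrite !big_ord_recl big_ord0 addr0 addrA.
by congr (_ + F _ + F _); apply: val_inj.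
Qed.

(** * Order-one anticoherence of a spin-1 state, through two qubits *)

Section Purity.
Variable C : numClosedFieldType.

(** Each bit string occurs in exactly one Dicke state, the one indexed by its number of ones, so a
    single term of the double sum survives. *)
Lemma dicke_embedding_ket n (psi : 'cV[C]_n.+1) (x : n.-tuple bool)
    (k : 'I_n.+1) :
  count_mem true x = k ->
  dicke_embedding psi (enum_rank x) 0 = psi k 0 / sqrtC 'C(n, k)%:R.
Proof.
move=> xk; rewrite summxE (bigD1 k) //= big1 => [|l lk].
  rewrite addr0 !mxE summxE (bigD1 x) ?xk //= big1 => [|y /andP[_ yx]].
    by rewrite addr0 mxE !eqxx mulr1.
  by rewrite mxE (can_eq (@enum_rankK _)) eq_sym (negPf yx).
rewrite !mxE summxE big1 ?mulr0 // => y /eqP yl.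
rewrite mxE (can_eq (@enum_rankK _)); case: eqP => //= xy.
by move: lk; rewrite -val_eqE /= -yl -xk xy eqxx.
Qed.

Lemma big_tuple1 (F : 1.-tuple bool -> C) :
  \sum_x F x = F [tuple true] + F [tuple false].
Proof.
rewrite (reindex (fun a : bool => [tuple a])) ?big_bool //.
apply: onW_bij; exists (fun x : 1.-tuple bool => thead x) => [a|x] //.
by case: x => [[|a []] // sz]; apply: val_inj; rewrite /= /thead (tnth_nth a).
Qed.

Lemma big_tuple2 (F : 2.-tuple bool -> C) :
  \sum_x F x = F [tuple true; true] + F [tuple true; false]
             + (F [tuple false; true] + F [tuple false; false]).
Proof.
rewrite (reindex (fun a : bool * bool => [tuple a.1; a.2])) /=.
  by rewrite -(pair_bigA _ (fun a b : bool => F [tuple a; b])) /= !big_bool.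
apply: onW_bij.
exists (fun x : 2.-tuple bool => (thead x, tnth x (inord 1))) => [[a b]|x].
  by rewrite /thead !(tnth_nth a) /= inordK.
by case: x => [[|a [|b []]] // sz]; apply: val_inj;
  rewrite /= /thead !(tnth_nth a) /= inordK.
Qed.

Lemma partial_trace21 (rho : 'M[C]_(qdim 2)) (a b : bool) :
  partial_trace 1 rho (enum_rank [tuple a]) (enum_rank [tuple b]) =
  rho (enum_rank [tuple a; true]) (enum_rank [tuple b; true]) +
  rho (enum_rank [tuple a; false]) (enum_rank [tuple b; false]).
Proof.
rewrite mxE /bits !enum_rankK big_mkcond big_tuple2.
(* One inner sum for each of the four values of the outer string. *)
do 4!rewrite big_mkcond big_tuple2.
by case: a; case: b; rewrite /= ?(addr0, add0r).
Qed.

(** The Cayley-Hamilton identity tr(rho^2) = (tr rho)^2 - 2 det rho in dimension 2. *)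
Lemma purity_qubit (rho : 'M[C]_(qdim 1)) (r := fun a b : bool =>
    rho (enum_rank [tuple a]) (enum_rank [tuple b])) :
  purity rho = (r true true + r false false) ^+ 2
    - 2 * (r true true * r false false - r true false * r false true).
Proof.
have trE (F : 'I_(qdim 1) -> C) :
    \sum_i F i = F (enum_rank [tuple true]) + F (enum_rank [tuple false]).
  by rewrite (reindex enum_rank) ?big_tuple1 //; apply/onW_bij/enum_rank_bij.
by rewrite /purity /mxtrace trE !mxE !trE -!/(r _ _); ring.
Qed.

Lemma projectorE d (phi : 'cV[C]_d) i j :
  projector phi i j = phi i 0 * (phi j 0)^*.
Proof. by rewrite mxE big_ord1 !mxE. Qed.

(** As rho_1 has trace 1, the anticoherence is 4 det rho_1. Moreover rho_1 = M M^* for the 2 x 2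
    matrix M of two-qubit coordinates, whose determinant is psi_0 psi_2 - psi_1^2 / 2. *)
Lemma anticoherence_spin1 (psi : 'cV[C]_3) :
  \sum_k `|psi k 0| ^+ 2 = 1 ->
  anticoherence 1 psi
    = `|psi (inord 1) 0 ^+ 2 - 2 * psi (inord 0) 0 * psi (inord 2) 0| ^+ 2.
Proof.
rewrite !big_ord_recl big_ord0 addr0 => n1.
rewrite /anticoherence /reduced_purity purity_qubit.
rewrite !partial_trace21 !projectorE.
rewrite (@dicke_embedding_ket 2 psi [tuple false; false] (inord 0)) ?inordK //.
rewrite (@dicke_embedding_ket 2 psi [tuple true; false] (inord 1)) ?inordK //.
rewrite (@dicke_embedding_ket 2 psi [tuple false; true] (inord 1)) ?inordK //.
rewrite (@dicke_embedding_ket 2 psi [tuple true; true] (inord 2)) ?inordK //.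
rewrite bin0 binn bin1 sqrtC1 !divr1.
set s := sqrtC 2.
have s2 : s ^+ 2 = 2 by rewrite sqrtCK.
have s0 : s != 0 by rewrite sqrtC_eq0 pnatr_eq0.
have sV : s^-1 ^+ 2 = 2^-1 by rewrite exprVn s2.
have sc : s^-1^* = s^-1 by rewrite geC0_conj ?invr_ge0 ?sqrtC_ge0 ?ler0n.
have E0 : ord0 = inord 0 :> 'I_3 by apply: val_inj; rewrite /= inordK.
have E1 : lift ord0 ord0 = inord 1 :> 'I_3 by apply: val_inj; rewrite /= inordK.
have E2 : lift ord0 (lift ord0 ord0) = inord 2 :> 'I_3
  by apply: val_inj; rewrite /= inordK.
rewrite E2 E1 E0 !normCK in n1 *.
rewrite !rmorphM /= rmorphB !rmorphM rmorph_nat /= sc.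
move: n1; set a := psi _ _; set b := psi _ _; set c := psi _ _.
(* The goal is polynomial in the coordinates and their conjugates, so these become independent
   variables; of [w] only w^2 = 1/2 is kept. Below, [b] and [b'] enter only through d = b w and d' =
   b' w. *)
move: a^* b^* c^* s^-1 sV => a' b' c' w w2 n1.
have dbl x y : x * y = 2 * (x * w * (y * w)).
  by rewrite mulrACA -expr2 w2; field.
move: n1; rewrite (expr2 b) (dbl b b) (dbl b b') (dbl b' b').
move: (b * w) (b' * w) => d d' n1.
(* The trace of rho_1 is the squared norm of [psi]. *)
have -> : c * c' + d * d' + (d * d' + a * a') = 1 by rewrite -n1; ring.
by field.
Qed.
End Purity.

(** * Diagonals of unitary and of symmetric unitary matrices *)

Section SymmetricUnitary.
Variable C : numClosedFieldType.

Lemma unitary_normsq m n (W : 'M[C]_(m, n)) i :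
  W \is unitarymx -> \sum_j `|W i j| ^+ 2 = 1.
Proof.
move=> /unitarymxP/matrixP/(_ i i); rewrite !mxE eqxx => e.
rewrite -[1]/(true%:R) -e.
by apply: eq_bigr => j _; rewrite !mxE normCK.
Qed.

Lemma unitary_normsq_le1 m n (W : 'M[C]_(m, n)) i j :
  W \is unitarymx -> `|W i j| ^+ 2 <= 1.
Proof.
move=> /(unitary_normsq i) <-; rewrite (bigD1 j) //= lerDl.
by apply: sumr_ge0 => k _; rewrite exprn_ge0.
Qed.

Lemma sum_diag_unitary_le n (W : 'M[C]_n) :
  W \is unitarymx -> \sum_i `|W i i| ^+ 2 <= n%:R.
Proof.
move=> Wu; rewrite -[n in n%:R]card_ord -sumr_const.
by apply: ler_sum => i _; apply: unitary_normsq_le1.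
Qed.

Lemma sqr_le_of_prod_le (p q r s1 s2 s3 : C) :
  0 < p -> 0 < q -> 0 <= r -> 0 <= s1 -> 0 <= s2 -> 0 <= s3 ->
  q * r <= p * (s1 + s2) -> p * r <= q * (s1 + s3) ->
  r ^+ 2 <= (s1 + s2) * (s1 + s3).
Proof.
move=> p0 q0 r0 s10 s20 s30 h1 h2.
rewrite -(ler_pM2l (mulr_gt0 p0 q0)).
have -> : p * q * r ^+ 2 = q * r * (p * r) by ring.
have -> : p * q * ((s1 + s2) * (s1 + s3)) = p * (s1 + s2) * (q * (s1 + s3))
  by ring.
by apply: ler_pM => //; rewrite mulr_ge0 // ltW.
Qed.

Lemma sym_unitary_diag_ineq (p q r s1 s2 s3 : C) :
  0 <= p -> 0 <= q -> 0 <= r -> 0 <= s1 -> 0 <= s2 -> 0 <= s3 ->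
  s1 ^+ 2 + p ^+ 2 + q ^+ 2 = 1 ->
  s2 ^+ 2 + p ^+ 2 + r ^+ 2 = 1 ->
  s3 ^+ 2 + q ^+ 2 + r ^+ 2 = 1 ->
  q * r <= p * (s1 + s2) -> p * r <= q * (s1 + s3) -> p * q <= r * (s2 + s3) ->
  1 <= 3 * (s1 ^+ 2 + s2 ^+ 2 + s3 ^+ 2).
Proof.
move=> p0 q0 r0 s10 s20 s30 n1 n2 n3 h1 h2 h3.
have sq (x : C) : 0 <= x -> 0 <= x ^+ 2 by move=> ?; rewrite exprn_ge0.
have big (x y z w : C) : 0 <= y -> 0 <= z -> x ^+ 2 = 1 ->
    w = x ^+ 2 + y ^+ 2 + z ^+ 2 -> 1 <= 3 * w.
  move=> y0 z0 -> ->; rewrite -[leLHS]mul1r ler_pM // ?ler1n //.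
  by rewrite -addrA lerDl addr_ge0 ?sq.
have prod0 (x y : C) : 0 <= x -> 0 <= y -> x * y <= 0 -> x = 0 \/ y = 0.
  move=> x0 y0 xy; have: x * y == 0 by rewrite eq_le xy mulr_ge0.
  by rewrite mulf_eq0 => /orP[] /eqP; [left | right].
(* Degenerate cases: if one of p, q, r vanishes, the inequalities make a second one vanish. Some row
   then reduces to its diagonal entry, of modulus 1, and [big] concludes. *)
have [pz|pn] := eqVneq p 0.
  rewrite pz mul0r in h1; have [z|z] := prod0 _ _ q0 r0 h1.
    by apply: (big s1 s2 s3) => //; rewrite -n1 pz z; ring.
  by apply: (big s2 s1 s3) => //; [rewrite -n2 pz z|]; ring.
have [qz|qn] := eqVneq q 0.
  rewrite qz mul0r in h2; have [z|z] := prod0 _ _ p0 r0 h2.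
    by rewrite z eqxx in pn.
  by apply: (big s3 s1 s2) => //; [rewrite -n3 qz z|]; ring.
have [rz|rn] := eqVneq r 0.
  rewrite rz mul0r in h3.
  by case: (prod0 _ _ p0 q0 h3) => z; rewrite z eqxx in pn qn.
have {pn}pp : 0 < p by rewrite lt0r pn.
have {qn}qp : 0 < q by rewrite lt0r qn.
have {rn}rp : 0 < r by rewrite lt0r rn.
have k1 := sqr_le_of_prod_le pp qp r0 s10 s20 s30 h1 h2.
have k2 : q ^+ 2 <= (s1 + s2) * (s2 + s3).
  rewrite (addrC s1).
  by apply: (sqr_le_of_prod_le pp rp q0) => //; rewrite 1?mulrC // addrC.
have k3 : p ^+ 2 <= (s1 + s3) * (s2 + s3).
  rewrite (addrC s1) (addrC s2).
  by apply: (sqr_le_of_prod_le qp rp p0) => //; rewrite 1?mulrC // addrC.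
have dsq (x y : C) : 0 <= x -> 0 <= y -> 0 <= (x - y) ^+ 2.
  by move=> x0 y0; rewrite real_exprn_even_ge0 // rpredB ?ger0_real.
have k := lerD k1 (lerD k2 k3).
have d0 := addr_ge0 (dsq s1 s2 s10 s20) 
  (addr_ge0 (dsq s1 s3 s10 s30) (dsq s2 s3 s20 s30)).
rewrite -(ler_pM2l (_ : 0 < 3)) ?ltr0n // -subr_ge0.
rewrite -subr_ge0 in k.
(* Let S, E and P be the sums of the s_i^2, of the s_i s_j with i < j, and of p^2, q^2, r^2. Then 3
   = S + 2 P, [k] is P <= S + 3 E, and [d0] is 0 <= 2 S - 2 E. Adding [k] twice and [d0] three times
   gives 3 <= 9 S. *)
have N : 3 = s1 ^+ 2 + p ^+ 2 + q ^+ 2 + (s2 ^+ 2 + p ^+ 2 + r ^+ 2)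
           + (s3 ^+ 2 + q ^+ 2 + r ^+ 2) by rewrite n1 n2 n3; ring.
rewrite mulr1 [X in _ - X]N.
have := addr_ge0 (mulr_ge0 (ler0n C 2) k) (mulr_ge0 (ler0n C 3) d0).
by congr (_ <= _); ring.
Qed.

(** By symmetry, two of the three terms in the orthogonality relation of rows i and j contain an
    entry of modulus |W_ij|; the triangle inequality isolates the third. *)
Lemma sum_diag_sym_unitary_ge (W : 'M[C]_3) :
  W \is unitarymx -> W^T = W -> 1 <= 3 * \sum_i `|W i i| ^+ 2.
Proof.
move=> Wu Ws.
have sym i j : W i j = W j i by rewrite -{1}Ws mxE.
have n (i : 'I_3) : `|W i 0| ^+ 2 + `|W i 1| ^+ 2 + `|W i 2| ^+ 2 = 1.
  by rewrite -(unitary_normsq i Wu) sum_ord3.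
have orth i j : i != j ->
    W i 0 * (W j 0)^* + W i 1 * (W j 1)^* + W i 2 * (W j 2)^* = 0.
  move=> ij; have /unitarymxP/matrixP/(_ i j) := Wu.
  by rewrite !mxE (negPf ij) sum_ord3 !mxE.
have tri (x y z : C) : x + y + z = 0 -> `|z| <= `|x| + `|y|.
  by move/eqP; rewrite addrC addr_eq0 => /eqP ->; rewrite normrN ler_normD.
rewrite sum_ord3.
apply: (@sym_unitary_diag_ineq `|W 0 1| `|W 0 2| `|W 1 2|) => //.
- by rewrite -(n 1) (sym 1 0); ring.
- by rewrite -(n 2) (sym 2 0) (sym 2 1); ring.
- have := tri _ _ _ (orth 0 1 isT).
  rewrite !normrM !norm_conjC (sym 1 0) => /le_trans-> //.
  by rewrite le_eqVlt; apply/orP; left; apply/eqP; ring.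
(* The term to isolate is the middle one here and the first one for rows 1 and 2; [tri] expects it
   last. *)
- have := orth 0 2 isT; rewrite addrAC => /tri.
  rewrite !normrM !norm_conjC (sym 2 0) (sym 2 1) => /le_trans-> //.
  by rewrite le_eqVlt; apply/orP; left; apply/eqP; ring.
- have := orth 1 2 isT; rewrite -addrA addrC => /tri.
  rewrite !normrM !norm_conjC (sym 1 0) (sym 2 0) (sym 2 1) => /le_trans-> //.
  by rewrite le_eqVlt; apply/orP; left; apply/eqP; ring.
Qed.
End SymmetricUnitary.

(** * Bounds on the quantumness of spin-1 bases *)

Section Spin1Quantumness.
Variable C : numClosedFieldType.

(* The matrix of the quadratic form psi |-> psi_0^2 - 2 psi_1 psi_(-1), the
   subscripts being the values of m. *)
Definition spin1_form : 'M[C]_3 :=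
  \matrix_(i, j) ((-1) ^+ i.+1 *+ (i + j == 2)%N).

Lemma spin1_form_sym : spin1_form^T = spin1_form.
Proof.
apply/matrixP => i j; rewrite !mxE addnC; case: eqP => // ij.
by case: i j ij => [[|[|[|?]]] ?] [[|[|[|?]]] ?] //= _; ring.
Qed.

Lemma spin1_form_unitary : spin1_form \is unitarymx.
Proof.
apply/unitarymxP/matrixP => i j; rewrite !mxE sum_ord3 !mxE.
case: i j => [[|[|[|?]]] ?] [[|[|[|?]]] ?] //=;
  by rewrite ?(mulr0n, mulr1n, mul0r, mulr0, rmorph0, rmorphXn, rmorphN1) //=
    ?(add0r, addr0) -?expr2 ?sqrr_sign ?mulr1n.
Qed.

Lemma quantumness_spin1 (U : 'M[C]_3) : U \is unitarymx ->
  quantumness 1 U = 3^-1 * \sum_i `|U 1 i ^+ 2 - 2 * U 0 i * U 2 i| ^+ 2.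
Proof.
move=> Uu; congr (_ * _); apply: eq_bigr => i _.
rewrite anticoherence_spin1; first by rewrite !mxE !inord3.
(* The columns of [U] are the rows of the unitary matrix [U^T]. *)
rewrite -(unitary_normsq (W := U^T) i) ?trmx_unitary //.
by apply: eq_bigr => k _; rewrite !mxE.
Qed.

Lemma spin1_form_diag (U : 'M[C]_3) i :
  (U^T *m spin1_form *m U) i i = U 1 i ^+ 2 - 2 * U 0 i * U 2 i.
Proof. by rewrite !mxE sum_ord3 !mxE !sum_ord3 !mxE /=; ring. Qed.

Lemma quantumness_spin1_bounds (U : 'M[C]_3) : U \is unitarymx ->
  1 / 9 <= quantumness 1 U /\ quantumness 1 U <= 1.
Proof.
move=> Uu; rewrite quantumness_spin1 //.
under eq_bigr do rewrite -spin1_form_diag.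
(* Congruence by the transpose, not the adjoint, keeps the matrix symmetric as well as unitary. *)
set W := _ *m U.
have Wu : W \is unitarymx.
  by rewrite !mul_unitarymx ?trmx_unitary ?spin1_form_unitary.
have Ws : W^T = W by rewrite !trmx_mul trmxK spin1_form_sym mulmxA.
split; last by rewrite ler_pdivrMl ?ltr0n // mulr1 sum_diag_unitary_le.
have -> : 1 / 9 = 3^-1 * (3^-1 * 1) :> C by field.
rewrite ler_pM2l ?invr_gt0 ?ltr0n // ler_pdivrMl ?ltr0n //.
exact: sum_diag_sym_unitary_ge.
Qed.

Lemma cV3_eq (u v : 'cV[C]_3) :
  u 0 0 = v 0 0 -> u 1 0 = v 1 0 -> u 2 0 = v 2 0 -> u = v.
Proof.
move=> e0 e1 e2; apply/matrixP => k l; rewrite (ord1 l).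
case: k => [[|[|[|//]]] lt3].
- by rewrite (_ : Ordinal lt3 = 0) //; apply: val_inj.
- by rewrite (_ : Ordinal lt3 = 1) //; apply: val_inj.
- by rewrite (_ : Ordinal lt3 = 2) //; apply: val_inj.
Qed.

Lemma spin1_expansion (u : 'cV[C]_3) :
  u = u 0 0 *: ket_p1 + u 1 0 *: ket_0 + u 2 0 *: ket_m1.
Proof.
by apply: cV3_eq; rewrite !mxE !inord3 /= ?(mulr1, mulr0) ?(addr0, add0r).
Qed.

End Spin1Quantumness.

(** * The two extremal bases *)

Section ExtremalBases.
Variable R : realType.
Notation omega3 := (@omega3 R).

Lemma expiD (x y : R) : expi (x + y) = expi x * expi y.
Proof.
by rewrite /expi cosD sinD; congr Complex; rewrite addrC [X in X + _]mulrC.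
Qed.

Lemma expi_conj (x : R) : (expi x)^* * expi x = 1.
Proof.
apply/eqP; rewrite eq_complex /=; apply/andP; split; apply/eqP; last by ring.
by rewrite -(cos2Dsin2 x); ring.
Qed.

Lemma norm_omega3 : `|omega3| = 1.
Proof.
by apply/eqP; rewrite -sqrp_eq1 // normCK mulrC expi_conj.
Qed.

Lemma omega3_cubed : omega3 ^+ 3 = 1.
Proof.
rewrite !exprS expr0 mulr1 -!expiD.
have -> : 2 * pi / 3 + (2 * pi / 3 + 2 * pi / 3) = pi *+ 2 :> R by field.
by rewrite /expi cos2pi sin2pi.
Qed.

(** This is the cofactor of omega3 - 1 in omega3^3 - 1 = 0, and omega3 differs from 1 because its
    imaginary part sin(2 pi / 3) is positive. *)
Lemma omega3_sum : 1 + omega3 + omega3 ^+ 2 = 0.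
Proof.
have : (omega3 - 1) * (1 + omega3 + omega3 ^+ 2) = 0.
  by rewrite -[RHS](subrr 1) -[X in _ = X - _]omega3_cubed; ring.
move/eqP; rewrite mulf_eq0 subr_eq0 => /orP[/eqP w1|/eqP //].
have : 0 < sin (2 * pi / 3 : R).
  apply: sin_gt0_pi; rewrite divr_gt0 ?mulr_gt0 ?pi_gt0 //=.
  by rewrite ltr_pdivrMr // mulrC ltr_pM2l ?pi_gt0 // ltr_nat.
by have /(congr1 (@complex.Im R)) /= -> := w1; rewrite ltxx.
Qed.

Lemma conj_omega3 : omega3^* = omega3 ^+ 2.
Proof.
by rewrite -[LHS]mulr1 -omega3_cubed exprSr mulrA mulrCA expi_conj mulr1.
Qed.

(** [U3c] is the discrete Fourier matrix of order 3. *)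
Lemma U3cE (i j : 'I_3) : U3c R i j = (sqrtC 3)^-1 * omega3 ^+ (i * j).
Proof.
rewrite !mxE; congr (_ * _).
by case: i j => [[|[|[|?]]] ?] [[|[|[|?]]] ?] //=;
  rewrite exprS omega3_cubed mulr1.
Qed.

Lemma U3c_unitary : U3c R \is unitarymx.
Proof.
have conjE k l : map_mx Num.conj (U3c R)^T k l
    = (sqrtC 3)^-1 * omega3 ^+ (2 * (l * k)).
  rewrite mxE mxE U3cE rmorphM rmorphXn /= conj_omega3 -exprM.
  by rewrite geC0_conj ?invr_ge0 ?sqrtC_ge0 ?ler0n.
have sV : (sqrtC 3)^-1 ^+ 2 = 3^-1 :> R[i] by rewrite exprVn sqrtCK.
have w2sum : 1 + omega3 ^+ 2 + omega3 ^+ 4 = 0.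
  by rewrite (exprD _ 3 1) omega3_cubed mul1r expr1 -[RHS]omega3_sum addrAC.
apply/unitarymxP/matrixP => i j.
(* A geometric sum of ratio omega3^(i - j), where 2 j stands for - j modulo 3 to keep exponents
   natural. *)
have {conjE}-> : (U3c R *m map_mx Num.conj (U3c R)^T) i j
    = 3^-1 * (1 + omega3 ^+ (i + 2 * j) + omega3 ^+ (i + 2 * j) ^+ 2).
  by rewrite mxE sum_ord3 !conjE !U3cE -sV !muln0 !muln1 !exprD !exprM /=; ring.
have -> : 1%:M i j = ((i + 2 * j) %% 3 == 0)%N%:R :> R[i].
  by rewrite mxE; case: i j => [[|[|[|?]]] ?] [[|[|[|?]]] ?].
rewrite -(expr_mod (i + 2 * j) omega3_cubed).
case: (_ %% 3)%N (ltn_pmod (i + 2 * j) (isT : 0 < 3)%N) => [|[|[|//]]] _ /=.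
- by rewrite expr0; field.
- by rewrite expr1 omega3_sum mulr0.
- by rewrite -exprM w2sum mulr0.
Qed.

(** On column i the quadratic form is (1 - 2) omega3^(2 i) / 3, of modulus 1/3. *)
Lemma quantumness_U3c : quantumness 1 (U3c R) = 1 / 9.
Proof.
rewrite quantumness_spin1 ?U3c_unitary //.
under eq_bigr => i _.
  rewrite !U3cE.
  have -> : ((sqrtC 3)^-1 * omega3 ^+ (1%R * i)) ^+ 2
      - 2 * ((sqrtC 3)^-1 * omega3 ^+ (0%R * i))
        * ((sqrtC 3)^-1 * omega3 ^+ (2%R * i))
     = - ((sqrtC 3)^-1 ^+ 2 * omega3 ^+ (2 * i)) :> R[i].
    by rewrite mul1n mul0n expr0 !(mulnC _ (i : nat)) exprM /=; ring.
  rewrite normrN exprVn sqrtCK normrM normrX norm_omega3 expr1n mulr1.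
  rewrite ger0_norm ?invr_ge0 ?ler0n //.
  over.
by rewrite sumr_const card_ord; field.
Qed.

Let r2 : R[i] := (sqrtC 2)^-1.

Lemma U3qE : U3q R =
  mx_of_rows 3 3 [:: [:: 0; r2; r2]; [:: 1; 0; 0]; [:: 0; r2; - r2]].
Proof.
have s0 : sqrtC 2 != 0 :> R[i] by rewrite sqrtC_eq0 pnatr_eq0.
apply/matrixP => i j; rewrite !mxE.
by case: i j => [[|[|[|?]]] ?] [[|[|[|?]]] ?] //=;
  rewrite ?(mulr0, mulr1, mulrN, mulVf).
Qed.

Lemma r2_sqr : r2 ^+ 2 = 2^-1. Proof. by rewrite exprVn sqrtCK. Qed.

Lemma conj_r2 : r2^* = r2.
Proof. by rewrite geC0_conj ?invr_ge0 ?sqrtC_ge0 ?ler0n. Qed.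

Lemma U3q_unitary : U3q R \is unitarymx.
Proof.
have h : 2^-1 + 2^-1 = 1 :> R[i] by field.
rewrite U3qE; apply/unitarymxP/matrixP => i j; rewrite !mxE sum_ord3 !mxE.
case: i j => [[|[|[|?]]] ?] [[|[|[|?]]] ?] //=;
  rewrite ?(rmorphN, rmorph0, rmorph1, conj_r2) /= ?conj_r2
    ?(mul0r, mulr0, mulr1, add0r, addr0, mulrN, mulNr, opprK, subrr) //;
  by rewrite -expr2 r2_sqr h.
Qed.

(** The quadratic form takes the values 1, -1, 1 on the columns, all of modulus 1. *)
Lemma quantumness_U3q : quantumness 1 (U3q R) = 1.
Proof.
rewrite quantumness_spin1 ?U3q_unitary // U3qE sum_ord3 !mxE /=.
rewrite !mulrN opprK expr0n sub0r add0r !mulr0 subr0 -mulrA -expr2 r2_sqr.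
by rewrite divff ?pnatr_eq0 // normrN !(normr1, expr1n); field.
Qed.

End ExtremalBases.

Theorem proposition1 (R : realType) :
  [/\ col (inord 0) (U3c R) = (sqrtC 3)^-1 *: (ket_p1 + ket_0 + ket_m1),
      col (inord 1) (U3c R)
        = (sqrtC 3)^-1 *: (ket_p1 + omega3 *: ket_0 + omega3 ^+ 2 *: ket_m1)
    & col (inord 2) (U3c R)
        = (sqrtC 3)^-1 *: (ket_p1 + omega3 ^+ 2 *: ket_0 + omega3 *: ket_m1)]
  /\
  [/\ col (inord 0) (U3q R) = ket_0,
      col (inord 1) (U3q R) = (sqrtC 2)^-1 *: (ket_p1 + ket_m1)
    & col (inord 2) (U3q R) = (sqrtC 2)^-1 *: (ket_p1 - ket_m1)]
  /\
  [/\ least_quantum (U3c R),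
      most_quantum (U3q R),
      quantumness 1 (U3c R) = 1 / 9
    & quantumness 1 (U3q R) = 1]
  /\
  (forall U : 'M[R[i]]_3, U \is unitarymx ->
     1 / 9 <= quantumness 1 U /\ quantumness 1 U <= 1).
Proof.
have bounds (U : 'M[R[i]]_3) := @quantumness_spin1_bounds _ U.
split; last split; last split; last exact: bounds.
- split; rewrite [LHS]spin1_expansion !mxE /= !inord3 /=;
    by rewrite !scalerDr ?scalerA ?mulr1.
- have s0 : sqrtC 2 != 0 :> R[i] by rewrite sqrtC_eq0 pnatr_eq0.
  split; rewrite [LHS]spin1_expansion !mxE /= !inord3 /=
    ?(mulr0, mulr1, mulrN1) ?mulVf // ?(scale0r, scale1r, add0r, addr0) //.
    by rewrite scalerDr.
  by rewrite scalerBr scaleNr.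
(* Extremality holds because the two uniform bounds are the values attained. *)
- split; [split=> [|V /bounds[le_V _]] | split=> [|V /bounds[_ le_V]] | |].
  + exact: U3c_unitary.
  + by rewrite quantumness_U3c.
  + exact: U3q_unitary.
  + by rewrite quantumness_U3q.
  + exact: quantumness_U3c.
  + exact: quantumness_U3q.
Qed.
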